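(* There is a dilatory $\varphi$-function $G$ such that the Orlicz--Lorentz space $L_{1,G}$ is not a quasi-Banach space.
   Context: A $\varphi$-function is a continuous, strictly increasing function $F:[0,\infty)\to[0,\infty)$ with $F(0)=0$ and $\lim_{t\to\infty}F(t)=\infty$. It is dilatory if there are $1<c_1,c_2<\infty$ with $F(c_1t)\ge c_2F(t)$ for all $t\ge0$. For a $\varphi$-function $F$ put $\tilde F(t)=1/F(1/t)$ for $t>0$ and $\tilde F(0)=0$. Functions live on $[0,\infty)$ with Lebesgue measure $\lambda$; $f^*(x)=\sup\{t:\lambda(|f|\ge t)\ge x\}$. Luxemburg functional: $\|f\|_G=\inf\{c>0:\int_0^\infty G(|f(x)|/c)\,dx\le1\}$. The space $L_{1,G}$ consists of measurable $f$ (modulo a.e. equality) with $\|f\|_{1,G}=\|f^*\circ\tilde G^{-1}\|_G<\infty$, equipped with the functional $\|\cdot\|_{1,G}$. *)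

(* Defs.v *)
From HB Require Import structures.
From mathcomp Require Import all_boot all_order all_algebra.
From mathcomp Require Import all_classical all_reals all_analysis.
Set Implicit Arguments. Unset Strict Implicit. Unset Printing Implicit Defensive.
Import Order.TTheory GRing.Theory Num.Theory.
Import numFieldNormedType.Exports.
Local Open Scope classical_set_scope.
Local Open Scope ring_scope.

Section OrliczLorentz.
Variable R : realType.
Local Notation mu := (@lebesgue_measure R).

Definition nonneg : set R := [set x : R | 0 <= x].

Definition phi_function (F : R -> R) : Prop :=
  [/\ {within `[0, +oo[, continuous F},
      (forall x y, 0 <= x -> x < y -> F x < F y),
      F 0 = 0 &
      F x @[x --> +oo] --> +oo].

Definition dilatory (F : R -> R) : Prop :=
  exists c1 c2 : R, [/\ 1 < c1, 1 < c2 &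
    forall t, 0 <= t -> c2 * F t <= F (c1 * t)].

Definition phi_tilde (F : R -> R) (t : R) : R :=
  if 0 < t then (F t^-1)^-1 else 0.

Definition phi_inv (F : R -> R) (y : R) : R :=
  sup [set t : R | 0 <= t /\ F t <= y].

Definition level_set (f : R -> R) (t : R) : set R :=
  nonneg `&` (fun y => t <= `|f y|).

Definition rearr (f : R -> R) (x : R) : \bar R :=
  ereal_sup [set t%:E | t in [set t : R | 0 <= t /\
     (x%:E <= mu (level_set f t))%E]].

Definition ext_phi (G : R -> R) (e : \bar R) : \bar R :=
  match e with
  | r%:E => (G r)%:E
  | +oo%E => +oo%E
  | -oo%E => 0%E
  end.

Definition luxemburg (G : R -> R) (h : R -> \bar R) : \bar R :=
  ereal_inf [set c%:E | c in [set c : R | 0 < c /\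
     (\int[mu]_(x in nonneg) ext_phi G (h x * (c^-1)%:E) <= 1)%E]].

Definition norm1G (G : R -> R) (f : R -> R) : \bar R :=
  luxemburg G (fun x => rearr f (phi_inv (phi_tilde G) x)).

(* the space L_{1,G} (representatives; the functional is a.e.-invariant) *)
Definition L1G (G : R -> R) : set (R -> R) :=
  [set f | measurable_fun nonneg f /\ (norm1G G f < +oo)%E].

Definition quasi_Banach_L1G (G : R -> R) : Prop :=
  [/\ ((forall f g, L1G G f -> L1G G g -> L1G G (fun x => f x + g x)%R) /\
       (forall (a : R) f, L1G G f -> L1G G (fun x => a * f x))),
      (forall f, L1G G f ->
         (norm1G G f = 0%E <->
          mu.-negligible (nonneg `&` [set x | f x != 0]))),
      (forall (a : R) f, L1G G f ->
         norm1G G (fun x => a * f x) = (`|a|%:E * norm1G G f)%E),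
      (exists C : R, 1 <= C /\ forall f g, L1G G f -> L1G G g ->
         (norm1G G (fun x => f x + g x)%R <= C%:E * (norm1G G f + norm1G G g))%E) &
      (forall u : nat -> R -> R, (forall n, L1G G (u n)) ->
         (forall eps : R, 0 < eps -> exists N, forall m n, (N <= m)%N -> (N <= n)%N ->
            (norm1G G (fun x => u n x - u m x)%R <= eps%:E)%E) ->
         exists2 f, L1G G f &
           forall eps : R, 0 < eps -> exists N, forall n, (N <= n)%N ->
            (norm1G G (fun x => u n x - f x)%R <= eps%:E)%E)].

End OrliczLorentz.

(* Main.v *)
(** With knots [q_j = 2 ^ (j ^ 2)], let [G] be the convex piecewise linear
    function of slope [q_j] between [q_(j-1)] and [q_j].  Then [G] is multiplied
    by at least [2 ^ (2 j + 1)] between [q_j] and [2 q_j], yet it is comparable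
    to a linear function on ever longer intervals ending at [q_j].

    Let [f] be nonincreasing with value [q_j] on
    (1 / (2 q_(j+1)), 1 / (2 q_j)].  Its modular is at most
    [sum_j G (q_j) / G (2 q_j) <= 1].  The sum [s] of [f] and a disjoint
    translate satisfies [s^* (x) = f^* (x / 2)], so the modular of [s / c] is
    bounded below by a sum of terms comparable to
    [G (q_j / c) / G (q_j) >= 1 / (2 c)], which diverges for every [c].  Hence
    [L_{1,G}] is not even closed under addition. *)
Require Import Defs.
From HB Require Import structures.
From mathcomp Require Import all_boot all_order all_algebra.
From mathcomp Require Import all_classical all_reals all_analysis.
From mathcomp Require Import measurable_realfun ring lra zify.
Set Implicit Arguments. Unset Strict Implicit. Unset Printing Implicit Defensive.
Import Order.TTheory GRing.Theory Num.Theory.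
Import numFieldNormedType.Exports.
Local Open Scope classical_set_scope.
Local Open Scope ring_scope.

(** * Knots and their growth *)

Definition knot (j : nat) : nat := (2 ^ (j * j))%N.

Lemma knotS (j : nat) : knot j.+1 = (knot j * 2 ^ (2 * j).+1)%N.
Proof. by rewrite /knot -expnD; congr (2 ^ _)%N; lia. Qed.

Lemma ltn_knot (j : nat) : (j < knot j)%N.
Proof.
by case: j => // j; apply: leq_trans (ltn_expl j.+1 (ltnSn 1)) _;
  rewrite leq_exp2l// leq_pmulr.
Qed.

Lemma knot_gt0 (j : nat) : (0 < knot j)%N.
Proof. by rewrite expn_gt0. Qed.

Lemma leq_knot (i j : nat) : (i <= j)%N -> (knot i <= knot j)%N.
Proof. by move=> ij; rewrite leq_exp2l// leq_mul. Qed.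

Lemma leq2knotS (j : nat) : (2 * knot j <= knot j.+1)%N.
Proof.
by rewrite knotS expnS mulnA mulnAC mulnC leq_mul// ?leq_pmulr ?expn_gt0// mulnC.
Qed.

(** * The convex piecewise linear function *)

Section PhiFunction.
Variable R : realType.
Implicit Types (t : R) (n j : nat).

Local Notation q j := ((knot j)%:R : R).

Lemma knotr_gt0 j : 0 < q j.
Proof. by rewrite ltr0n knot_gt0. Qed.

Lemma knotr_ge1 j : 1 <= q j.
Proof. by rewrite ler1n knot_gt0. Qed.

Lemma ler2knotS j : 2 * q j <= q j.+1.
Proof. by rewrite -natrM ler_nat leq2knotS. Qed.

Lemma ler_knotS j : q j <= q j.+1.
Proof. by rewrite ler_nat leq_knot. Qed.

(** The slope starts at [q 0 = 1], and the hinge at [q j] raises it from [q j] to [q j.+1]. *)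
Definition convex_pl n t : R :=
  t + \sum_(j < n) (q j.+1 - q j) * Num.max 0 (t - q j).

(* The terms of index at least [Num.truncn t] vanish at [t], so this is the
   infinite sum. *)
Definition convex_phi t : R := convex_pl (Num.truncn t) t.

Local Notation G := convex_phi.

Lemma convex_plS n t : convex_pl n.+1 t =
  convex_pl n t + (q n.+1 - q n) * Num.max 0 (t - q n).
Proof. by rewrite /convex_pl big_ord_recr /= addrA. Qed.

Lemma convex_pl_nd m n t : (m <= n)%N -> convex_pl m t <= convex_pl n t.
Proof.
elim: n => [|n IH]; first by rewrite leqn0 => /eqP ->.
rewrite leq_eqVlt => /orP[/eqP -> //|/IH]; move=> /le_trans; apply.
by rewrite convex_plS lerDl mulr_ge0// ?le_max ?lexx// subr_ge0 ler_knotS.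
Qed.

Lemma convex_pl_stable m n t : t <= q m -> (m <= n)%N ->
  convex_pl n t = convex_pl m t.
Proof.
move=> tm; elim: n => [|n IH]; first by rewrite leqn0 => /eqP ->.
rewrite leq_eqVlt => /orP[/eqP -> //|mn]; rewrite convex_plS IH//.
rewrite (_ : Num.max _ _ = 0) ?mulr0 ?addr0//; apply/max_idPl.
by rewrite subr_le0 (le_trans tm)// ler_nat leq_knot.
Qed.

Lemma lt_knot_truncn t : t < q (Num.truncn t).
Proof. by rewrite (lt_le_trans (truncnS_gt t))// ler_nat ltn_knot. Qed.

Lemma convex_phiE n t : t <= q n -> G t = convex_pl n t.
Proof.
move=> tn; have tt := ltW (lt_knot_truncn t).
have [h|/ltnW h] := leqP n (Num.truncn t); first exact: convex_pl_stable.
by rewrite /G (convex_pl_stable tt h).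
Qed.

Lemma convex_pl_le n t : convex_pl n t <= G t.
Proof.
have tt := ltW (lt_knot_truncn t).
have [h|/ltnW h] := leqP n (Num.truncn t); first exact: convex_pl_nd.
by rewrite /G (convex_pl_stable tt h).
Qed.

Lemma convex_pl_continuous n : continuous (convex_pl n).
Proof.
elim: n => [|n IH] x.
  rewrite (_ : convex_pl 0 = id); first exact: cvg_id.
  by apply/funext => t; rewrite /convex_pl big_ord0 addr0.
rewrite (_ : convex_pl n.+1 = convex_pl n \+
    (fun t => (q n.+1 - q n) *
      ((cst 0 : R -> R) \max (fun t => t - q n)) t)); last first.
  by apply/funext => t; rewrite convex_plS.
apply: (@continuousD _ R^o R) => //; first exact: IH.
apply: (@continuousM _ R); first exact: cst_continuous.
apply: continuous_max; first exact: cst_continuous.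
by apply: (@continuousB _ R^o R); [exact: cvg_id|exact: cst_continuous].
Qed.

(** Since [x] lies strictly below [q (Num.truncn x)], a single partial sum represents [G] on a whole
    neighbourhood of [x]. *)
Lemma convex_phi_continuous : continuous G.
Proof.
move=> x; have xq := lt_knot_truncn x.
rewrite /continuous_at (convex_phiE (ltW xq)).
apply: cvg_trans (@convex_pl_continuous (Num.truncn x) x).
apply: near_eq_cvg; near=> y; apply/esym/convex_phiE/ltW.
near: y; exact: lt_nbhsl.
Unshelve. all: by end_near. Qed.

Lemma convex_pl_incr n x y : x <= y -> y - x <= convex_pl n y - convex_pl n x.
Proof.
move=> xy; elim: n => [|n IH]; first by rewrite /convex_pl !big_ord0 !addr0.
rewrite !convex_plS.
have : (q n.+1 - q n) * Num.max 0 (x - q n) <=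
    (q n.+1 - q n) * Num.max 0 (y - q n).
  rewrite ler_wpM2l ?subr_ge0 ?ler_knotS//.
  by rewrite ge_max !le_max lexx/= lerB// orbT.
by move: IH; set a := convex_pl n y; set b := convex_pl n x; lra.
Qed.

Lemma convex_phi_incr x y : x <= y -> y - x <= G y - G x.
Proof.
move=> xy; have yq := ltW (lt_knot_truncn y).
by rewrite (convex_phiE yq) (convex_phiE (le_trans xy yq)) convex_pl_incr.
Qed.

Lemma convex_phi_lt x y : x < y -> G x < G y.
Proof.
move=> xy; rewrite -subr_gt0 (lt_le_trans _ (convex_phi_incr (ltW xy)))//.
by rewrite subr_gt0.
Qed.

Lemma convex_phi_nd x y : x <= y -> G x <= G y.
Proof. by rewrite le_eqVlt => /orP[/eqP -> //|/convex_phi_lt/ltW]. Qed.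

Lemma convex_phi_id t : t <= 1 -> G t = t.
Proof. by move=> t1; rewrite (@convex_phiE 0)// /convex_pl big_ord0 addr0. Qed.

Lemma convex_phi0 : G 0 = 0.
Proof. by rewrite convex_phi_id. Qed.

Lemma convex_phi_gt0 t : 0 < t -> 0 < G t.
Proof. by move=> t0; rewrite -convex_phi0 convex_phi_lt. Qed.

Lemma convex_phi_ge0 t : 0 <= t -> 0 <= G t.
Proof. by move=> t0; rewrite -convex_phi0 convex_phi_nd. Qed.

Lemma convex_phi_ge_id t : t <= G t.
Proof. by have := convex_pl_le 0 t; rewrite /convex_pl big_ord0 addr0. Qed.

(** The slopes up to [q n] are at most [q n]. In the induction each hinge is bounded by its slope
    jump times [t], and the jumps telescope. *)
Lemma convex_phi_le n t : 0 <= t -> t <= q n -> G t <= q n * t.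
Proof.
move=> t0 tn; rewrite (convex_phiE tn) => {tn}.
elim: n => [|n IH]; first by rewrite /convex_pl big_ord0 addr0 mul1r.
rewrite convex_plS.
have : (q n.+1 - q n) * Num.max 0 (t - q n) <= (q n.+1 - q n) * t.
  rewrite ler_wpM2l ?subr_ge0 ?ler_knotS// ge_max t0/=.
  by rewrite lerBlDr lerDl ltW ?knotr_gt0.
by move: IH; lra.
Qed.

(** From [q n] on, the slope is at least [q n.+1]. Dropping the maxima bounds [G] below by affine
    functions, which the induction compares using [q n <= q n.+1]. *)
Lemma convex_phi_ge n t : q n.+1 * (t - q n) <= G t.
Proof.
apply: le_trans (convex_pl_le n.+1 t).
elim: n => [|n IH].
  rewrite convex_plS /convex_pl big_ord0 addr0.
  have : (q 1 - q 0) * (t - q 0) <= (q 1 - q 0) * Num.max 0 (t - q 0).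
    by rewrite ler_wpM2l ?subr_ge0 ?ler_knotS// le_max lexx orbT.
  have -> : q 0 = 1 by [].
  have := knotr_ge1 1.
  lra.
rewrite convex_plS.
have : (q n.+2 - q n.+1) * (t - q n.+1) <=
    (q n.+2 - q n.+1) * Num.max 0 (t - q n.+1).
  by rewrite ler_wpM2l ?subr_ge0 ?ler_knotS// le_max lexx orbT.
have : q n.+1 * q n <= q n.+1 * q n.+1.
  by rewrite ler_wpM2l ?ler_knotS// ltW ?knotr_gt0.
move: IH; lra.
Qed.

(** This holds hinge by hinge; the hinges that matter at [2 * t] but not at [t] only increase the
    right-hand side. *)
Lemma convex_phi_double t : 0 <= t -> 2 * G t <= G (2 * t).
Proof.
move=> t0; apply: le_trans (convex_pl_le (Num.truncn t) (2 * t)).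
rewrite /G; elim: (Num.truncn t) => [|n IH].
  by rewrite /convex_pl !big_ord0 !addr0.
rewrite !convex_plS mulrDr lerD// mulrCA ler_wpM2l ?subr_ge0 ?ler_knotS//.
rewrite maxr_pMr// mulr0 ge_max !le_max lexx/=; apply/orP; right.
by have := knotr_gt0 n; lra.
Qed.

Lemma convex_phi_phi_function : phi_function G.
Proof.
split.
- exact/continuous_subspaceT/convex_phi_continuous.
- by move=> x y _; exact: convex_phi_lt.
- exact: convex_phi0.
- apply/cvgryPge => A; near=> x.
  by apply: le_trans (convex_phi_ge_id x); near: x; apply: nbhs_pinfty_ge; exact: num_real.
Unshelve. all: by end_near. Qed.

Lemma convex_phi_dilatory : dilatory G.
Proof. by exists 2, 2; split; [lra|lra|exact: convex_phi_double]. Qed.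

(** The chord bound gives [G (q j) <= q j * q j] and the tangent bound gives
    [q j.+1 * q j <= G (2 * q j)], so the quotient is at most [q j / q j.+1]. *)
Lemma convex_phi_jump j : G (q j) / G (2 * q j) <= (2 ^ (2 * j).+1)%:R^-1.
Proof.
have q0 := knotr_gt0 j.
rewrite ler_pdivrMr ?convex_phi_gt0 ?mulr_gt0//.
rewrite mulrC ler_pdivlMr ?ltr0n ?expn_gt0//.
apply: le_trans (convex_phi_ge j _).
rewrite knotS natrM mulrAC ler_wpM2r//.
have -> : 2 * q j - q j = q j by ring.
by apply: convex_phi_le => //; exact: ltW.
Qed.

Lemma convex_phi_knot_double j : 2 * G (q j) <= G (q j.+1).
Proof.
apply: le_trans (convex_phi_double (ltW (knotr_gt0 j))) _.
exact/convex_phi_nd/ler2knotS.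
Qed.

(** The tangent at [q j] gives [G (q j.+1 / c) >= q j.+1 * (q j.+1 / c - q j)]. As
    [2 * c * q j <= q j.+1], the subtracted knot costs at most half, and
    [G (q j.+1) <= q j.+1 * q j.+1]. *)
Lemma convex_phi_knot_div j (c : R) : 0 < c -> c <= j%:R ->
  G (q j.+1) / (2 * c) <= G (q j.+1 / c).
Proof.
move=> c0 cj; have q0 := knotr_gt0 j; have q1 := knotr_gt0 j.+1.
apply: le_trans (convex_phi_ge j _).
apply: (@le_trans _ _ (q j.+1 * q j.+1 / (2 * c))).
  rewrite ler_pM2r ?invr_gt0 ?mulr_gt0//.
  by apply: convex_phi_le => //; exact: ltW.
rewrite -mulrA ler_wpM2l ?(ltW q1)//.
have h : 2 * c * q j <= q j.+1.
  rewrite knotS natrM mulrC ler_wpM2l ?(ltW q0)// expnS natrM ler_wpM2l//.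
  apply: le_trans cj _; rewrite ler_nat.
  apply: leq_trans (ltnW (ltn_expl j (ltnSn 1))) _.
  by rewrite leq_exp2l// leq_pmull.
rewrite -(@ler_pM2r _ (2 * c)) ?mulr_gt0//.
rewrite mulrBl divfK ?gt_eqF ?mulr_gt0//.
have -> : q j.+1 / c * (2 * c) = 2 * q j.+1 by field; rewrite gt_eqF.
lra.
Qed.

End PhiFunction.

(** * Monotonicity of the integral *)

Section Integrals.
Local Open Scope ereal_scope.

(** Comes directly from the integral as a supremum over simple functions below the integrand. It
    spares a proof that the modular integrands are measurable. *)
Lemma ge0_le_integral_nomeas (d : measure_display) (T : measurableType d)
    (R : realType) (mu : {measure set T -> \bar R}) (D : set T)
    (f g : T -> \bar R) :
  (forall x, D x -> 0 <= f x) -> (forall x, D x -> f x <= g x) ->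
  \int[mu]_(x in D) f x <= \int[mu]_(x in D) g x.
Proof.
move=> f0 fg; rewrite !ge0_integralE//; last first.
  by move=> x Dx; exact: le_trans (f0 _ Dx) (fg _ Dx).
apply: le_ereal_sup => _ [h hf <-]; exists h => // x.
apply: le_trans (hf x) _; rewrite /patch; case: ifPn => //.
by rewrite inE => /fg.
Qed.

End Integrals.

(** * Comparing integrals with step functions *)

Section Steps.
Variable R : realType.
Local Notation mu := (@lebesgue_measure R).

Lemma nonnegE : @nonneg R = `[0, +oo[%classic.
Proof. by apply/seteqP; split => x /=; rewrite /nonneg/= in_itv/= andbT. Qed.

Lemma measurable_nonneg : measurable (@nonneg R).
Proof. by rewrite nonnegE. Qed.

Lemma integral_indic_itv (a b c : R) (l r : bool) :
  0 <= a -> 0 <= b -> b <= c ->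
  (\int[mu]_(x in @nonneg R)
    (a%:E * (\1_([set` Interval (BSide l b) (BSide r c)]) x)%:E) =
   (a * (c - b))%:E)%E.
Proof.
move=> a0 b0 bc; rewrite ge0_integralZl//; first last.
- exact/measurable_EFinP/measurable_indic.
- exact: measurable_nonneg.
rewrite integral_indic//; last exact: measurable_nonneg.
rewrite setIidl; last first.
  move=> x /=; rewrite in_itv/= /nonneg/= => /andP[bx _].
  by apply: le_trans b0 _; case: l bx => // /ltW.
rewrite /= lebesgue_measure_itv/= lte_fin EFinM.
case: ltP => [_|cb]; first by rewrite -EFinB.
by rewrite (@le_anti _ _ b c) ?bc// subrr.
Qed.

Lemma integral_steps_le (a b : nat -> R) (h : R -> \bar R) :
  (forall j, 0 <= a j) -> (forall j, 0 <= b j) ->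
  (forall x, 0 <= x -> (0 <= h x)%E) ->
  (forall x, 0 <= x ->
    (h x <= \sum_(0 <= j <oo) ((a j)%:E * (\1_(`[0%R, b j]) x)%:E))%E) ->
  (\int[mu]_(x in @nonneg R) h x <= \sum_(0 <= j <oo) (a j * b j)%:E)%E.
Proof.
move=> a0 b0 h0 hle; apply: le_trans (ge0_le_integral_nomeas mu h0 hle) _.
rewrite integral_nneseries; first last.
- by move=> n x _; rewrite mule_ge0// lee_fin.
- move=> n; apply: emeasurable_funM => //.
  exact/measurable_EFinP/measurable_indic.
- exact: measurable_nonneg.
apply: lee_nneseries => [j _ _|j _].
  by apply: integral_ge0 => x _; rewrite mule_ge0// lee_fin.
by rewrite integral_indic_itv// subr0.
Qed.

Lemma integral_steps_ge (a b : nat -> R) (h : R -> \bar R) (m : nat) :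
  (forall j, 0 <= a j) -> (forall j, 0 <= b j) -> (forall j, b j.+1 <= b j) ->
  (forall x, 0 <= x -> (0 <= h x)%E) ->
  (forall j x, 0 <= x -> x <= b j -> ((a j)%:E <= h x)%E) ->
  ((\sum_(j < m) a j * (b j - b j.+1))%:E <= \int[mu]_(x in @nonneg R) h x)%E.
Proof.
move=> a0 b0 bS h0 hge.
pose S m x : \bar R :=
  (\sum_(j < m) ((a j)%:E * (\1_(`](b j.+1), (b j)]) x)%:E))%E.
have S0 n x : (0 <= S n x)%E.
  by apply: sume_ge0 => j _; rewrite mule_ge0// lee_fin.
(* The second conjunct carries the disjointness of the steps: to the left of [b n] none of the first
   [n] steps is active, so at most one term of the sum is nonzero. *)
have Sle n x : 0 <= x -> (S n x <= h x)%E /\ (x <= b n -> S n x = 0%E).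
  move=> x0; elim: n => [|n [IH1 IH2]].
    by rewrite /S big_ord0; split => //; exact: h0.
  rewrite /S big_ord_recr/= -/(S n x) indicE.
  have [|_] := boolP (x \in `](b n.+1), (b n)]%classic).
    rewrite inE/= in_itv/= => /andP[bx xb]; rewrite IH2// mule1 add0e; split; first exact: hge.
    by move=> /(lt_le_trans bx); rewrite ltxx.
  rewrite mule0 adde0; split => // xb.
  by apply: IH2; exact: le_trans xb _.
have -> : (\sum_(j < m) a j * (b j - b j.+1))%:E =
    (\int[mu]_(x in @nonneg R) S m x)%E.
  rewrite /S ge0_integral_sum; first last.
  - by move=> n x _; rewrite mule_ge0// lee_fin.
  - move=> n; apply: emeasurable_funM => //.
    exact/measurable_EFinP/measurable_indic.
  - exact: measurable_nonneg.
  by rewrite -sumEFin; apply: eq_bigr => j _; rewrite integral_indic_itv.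
apply: ge0_le_integral_nomeas => x x0; first exact: S0.
by have [] := Sle m x x0.
Qed.

End Steps.

(** * The inverse of [phi_tilde G] and the extended modular *)

Section Inverse.
Variable R : realType.
Local Notation G := (@convex_phi R).

Lemma phi_inv_le (u x : R) : 0 < u -> 0 <= x -> x <= (G u)^-1 ->
  phi_inv (phi_tilde G) x <= u^-1.
Proof.
move=> u0 x0 xu; apply: ge_sup.
  by exists 0; split => //; rewrite /phi_tilde ltxx.
move=> t [t0]; rewrite /phi_tilde; case: ltP => [{}t0|t0' _]; last first.
  by apply: le_trans t0' _; rewrite invr_ge0 ltW.
move=> /le_trans/(_ xu); rewrite lef_pV2 ?posrE ?convex_phi_gt0 ?invr_gt0//.
move=> h; rewrite -[t]invrK lef_pV2 ?posrE ?invr_gt0// leNgt.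
by apply/negP => /convex_phi_lt; rewrite ltNge h.
Qed.

(** The intermediate value theorem yields [s < u] with [G s = x^-1]. Then [phi_tilde G] takes the
    value [x] at [s^-1 > u^-1], which makes the inequality strict. *)
Lemma lt_phi_inv (u x : R) : 0 < u -> (G u)^-1 < x ->
  u^-1 < phi_inv (phi_tilde G) x.
Proof.
move=> u0 ux; have Gu0 := convex_phi_gt0 u0.
have x0 : 0 < x by apply: lt_trans ux; rewrite invr_gt0.
have xu : x^-1 < G u by rewrite -[G u]invrK ltf_pV2 ?posrE ?invr_gt0.
have [s] : exists2 s, s \in `[0, u] & G s = x^-1.
  apply: IVT; first exact: ltW.
    exact/continuous_subspaceT/convex_phi_continuous.
  rewrite convex_phi0 ge_min le_max (ltW xu) orbT andbT.
  by rewrite invr_ge0 ltW.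
rewrite in_itv/= => /andP[s0 su] Gs.
have {}s0 : 0 < s.
  rewrite lt_neqAle s0 andbT; apply/eqP => s0'.
  by move: Gs; rewrite -s0' convex_phi0 => /esym/eqP; rewrite invr_eq0 gt_eqF.
have {}su : s < u.
  rewrite lt_neqAle su andbT; apply/eqP => s0'.
  by move: xu; rewrite -Gs s0' ltxx.
apply: (@lt_le_trans _ _ s^-1); first by rewrite ltf_pV2.
apply: ub_le_sup; last first.
  split; first by rewrite invr_ge0 ltW.
  by rewrite /phi_tilde invr_gt0 s0 invrK Gs invrK.
(* As [G] is the identity up to 1, [phi_tilde G] is the identity from 1 on; this bounds the set, so
   that its [sup] is a genuine one. *)
exists (Num.max 1 x) => t [t0]; rewrite /phi_tilde le_max.
case: ltP => [{}t0|t0' _]; last by rewrite (le_trans t0').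
have [//|t1 /=] := leP t 1.
by rewrite convex_phi_id ?invrK// invf_le1// ltW.
Qed.

Lemma ext_phi_le (e : \bar R) (r : R) : 0 <= r -> (e <= r%:E)%E ->
  (ext_phi G e <= (G r)%:E)%E.
Proof.
move=> r0; case: e => [s| |]//=; last by rewrite lee_fin convex_phi_ge0.
by rewrite !lee_fin; exact: convex_phi_nd.
Qed.

Lemma ext_phi_ge (e : \bar R) (r : R) : (r%:E <= e)%E ->
  ((G r)%:E <= ext_phi G e)%E.
Proof.
case: e => [s| |]//=; last by move=> _; rewrite leey.
by rewrite !lee_fin; exact: convex_phi_nd.
Qed.

Lemma rearr_ge0 (f : R -> R) (y : R) : (0 <= rearr f y)%E.
Proof.
apply: ereal_sup_ubound => /=; exists 0 => //; split => //.
have -> : level_set f 0 = `[0, +oo[%classic.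
  by rewrite -nonnegE /level_set; apply/setIidPl => x _; exact: normr_ge0.
by rewrite lebesgue_measure_itv/= ltry leey.
Qed.

Lemma ext_phi_rearr_ge0 (f : R -> R) (y c : R) : 0 <= c ->
  (0 <= ext_phi G (rearr f y * c%:E))%E.
Proof.
move=> c0; rewrite -[leLHS]/(0%:E) -{1}(convex_phi0 R).
by apply: ext_phi_ge; rewrite mule_ge0// rearr_ge0.
Qed.

End Inverse.

(** * The peak, its modular, and the sum of two disjoint peaks *)

Section Peak.
Variable R : realType.
Local Notation mu := (@lebesgue_measure R).
Local Notation G := (@convex_phi R).
Local Notation q j := ((knot j)%:R : R).

(* The bound [Num.truncn x^-1] on the index is not restrictive: the condition
   gives [j < 2 * knot j <= x^-1]. *)
Definition peak (x : R) : R :=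
  if 0 < x then
    (\max_(j < Num.truncn x^-1 | x <= (2 * q j)^-1) knot j)%:R
  else 0.

(** Measurability and both rearrangement bounds are read off this form. The hypothesis [0 < t] rules
    out the default value 0, taken for [x <= 0] and by the empty maximum. *)
Lemma peak_geP (t x : R) : 0 < t ->
  t <= peak x <-> exists j, [/\ t <= q j, 0 < x & x <= (2 * q j)^-1].
Proof.
move=> t0; rewrite /peak; split.
  case: ltP => [x0|_]; last by rewrite leNgt t0.
  apply: (big_ind (fun m : nat => t <= m%:R -> _)).
  - by rewrite leNgt t0.
  - by move=> m n IHm IHn; rewrite /maxn; case: ifP => _ /=.
  - by move=> j xj tj; exists j.
move=> [j [tj x0 xj]]; rewrite x0; apply: le_trans tj _; rewrite ler_nat.
have jx : (j < Num.truncn x^-1)%N.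
  rewrite truncn_gt_nat; apply: (@le_trans _ _ (2 * q j)).
    by rewrite -natrM ler_nat (leq_trans (ltn_knot j))// leq_pmull.
  by rewrite -[2 * q j]invrK lef_pV2// posrE invr_gt0 mulr_gt0// knotr_gt0.
exact: (@leq_bigmax_cond _ (fun j : 'I__ => x <= (2 * q j)^-1)
  (fun j : 'I__ => knot j) (Ordinal jx) xj).
Qed.

Lemma peak_ge0 x : 0 <= peak x.
Proof. by rewrite /peak; case: ifP. Qed.

Lemma measurable_peak : measurable_fun setT peak.
Proof.
apply: (measurability _ (RGenCInfty.measurableE R)) => //.
move=> _ [_ [t ->] <-]; rewrite setTI.
have [t0|t0] := leP t 0.
  rewrite (_ : _ @^-1` _ = setT)//; apply/seteqP; split => // x _ /=.
  by rewrite in_itv/= andbT (le_trans t0)// peak_ge0.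
rewrite (_ : _ @^-1` _ =
  \bigcup_j (if t <= q j then `]0, (2 * q j)^-1]%classic else set0)).
  by apply: bigcupT_measurable => j; case: ifP.
apply/seteqP; split => x /=; rewrite in_itv/= andbT.
  move=> /(peak_geP _ t0)[j [tj x0 xj]]; exists j => //=.
  by rewrite tj/= in_itv/= x0.
move=> [j _]; case: ifPn => // tj /=; rewrite in_itv/= => /andP[x0 xj].
by apply/(peak_geP _ t0); exists j.
Qed.

Lemma measurable_peak_shift (a : R) :
  measurable_fun (@nonneg R) (fun x => peak (x - a)).
Proof.
apply: (@measurable_funS _ _ _ _ setT) => //.
apply: measurableT_comp; first exact: measurable_peak.
exact: measurable_funB.
Qed.

Lemma measurable_level_set (f : R -> R) (t : R) :
  measurable_fun (@nonneg R) f -> measurable (level_set f t).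
Proof.
move=> mf; have mh : measurable_fun (@nonneg R) (fun x => `|f x|).
  exact: measurableT_comp.
have := mh (@measurable_nonneg R) `[t, +oo[%classic (measurable_itv _).
congr (measurable _); rewrite /level_set; congr (_ `&` _).
by apply/seteqP; split => x /=; rewrite in_itv/= andbT.
Qed.

Lemma lebesgue_measure_ocitv (a b : R) : 0 <= b ->
  mu `]a, (a + b)]%classic = b%:E.
Proof.
move=> b0; rewrite lebesgue_measure_itv/= lte_fin.
case: ltP => [_|ab]; first by rewrite -EFinB addrAC subrr add0r.
by congr EFin; apply/le_anti; rewrite b0; move: ab; rewrite gerDl.
Qed.

(** The value of [peak] just to the right of [(2 * q i)^-1]; it is 0 for [i = 0] because [peak]
    vanishes beyond 1/2. *)
Definition peak_height (i : nat) : R := if i is k.+1 then q k else 0.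

(** Knots increase, so a value above [peak_height i] can only come from an index [j >= i], hence
    from a point within [(2 * q i)^-1] of [a]. *)
Lemma level_set_peak_shift (a t : R) (i : nat) : peak_height i < t ->
  level_set (fun x => peak (x - a)) t `<=` `]a, (a + (2 * q i)^-1)]%classic.
Proof.
move=> it x [_]; rewrite ger0_norm ?peak_ge0// => tx.
have t0 : 0 < t by apply: le_lt_trans it; case: i.
move/(peak_geP _ t0) : tx => [j [tj x0 xj]] /=.
rewrite in_itv/= -subr_gt0 x0/= -lerBlDl (le_trans xj)//.
rewrite lef_pV2 ?posrE ?mulr_gt0 ?knotr_gt0// ler_pM2l// ler_nat leq_knot//.
case: i it => //= i it; have := lt_le_trans it tj.
by rewrite ltr_nat ltnNge; apply: contraNltn => ji; rewrite leq_knot.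
Qed.

Lemma rearr_peak_shift_le (a y : R) (i : nat) : (2 * q i)^-1 < y ->
  (rearr (fun x => peak (x - a)) y <= (peak_height i)%:E)%E.
Proof.
move=> iy; apply: ge_ereal_sup => _ [t [t0 yt] <-]; rewrite lee_fin leNgt.
apply/negP => it.
have q0 : 0 <= (2 * q i)^-1 by rewrite invr_ge0 mulr_ge0.
have : (y%:E <= (2 * q i)^-1%:E)%E.
  apply: le_trans yt _; rewrite -(lebesgue_measure_ocitv a q0).
  apply: le_measure; rewrite ?inE//.
    by apply: measurable_level_set; exact: measurable_peak_shift.
  exact: level_set_peak_shift.
by rewrite lee_fin leNgt iy.
Qed.

Lemma modular_peak_shift_le (a x : R) : 0 <= x ->
  (ext_phi G (rearr (fun z => peak (z - a)) (phi_inv (phi_tilde G) x)) <=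
   \sum_(0 <= j <oo)
     ((G (q j))%:E * (\1_(`[0%R, (G (2 * q j))^-1]) x)%:E))%E.
Proof.
have S0 (y : R) k :
    (0 <= (G (q k))%:E * (\1_(`[0%R, (G (2 * q k))^-1]) y)%:E)%E.
  by rewrite mule_ge0// lee_fin// convex_phi_ge0.
rewrite le_eqVlt => /predU1P[<-|x0].
  (* At [x = 0] every step is active with height at least 1, so the series is infinite. *)
  rewrite [leRHS](_ : _ = +oo%E) ?leey//; apply/eqyP => A _.
  apply: le_trans (nneseries_lim_ge (Num.truncn A).+1 _); last first.
    by move=> *; exact: S0.
  apply: (@le_trans _ _ (\sum_(0 <= j < (Num.truncn A).+1) 1)%:E).
    by rewrite sumr_const_nat subn0 lee_fin ltW// truncnS_gt.
  rewrite -sumEFin; apply: lee_sum => j _; rewrite indicE mem_set/=; last first.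
    by rewrite in_itv/= lexx/= invr_ge0 convex_phi_ge0// mulr_ge0.
  by rewrite mule1 lee_fin (le_trans (knotr_ge1 _ j))// convex_phi_ge_id.
have Gq0 k : 0 < G (2 * q k) by rewrite convex_phi_gt0// mulr_gt0// knotr_gt0.
(* For the least such [i], the rearrangement is at most [peak_height i]. If [i = k.+1], minimality
   puts [x] inside the step of index [k], whose height [G (q k)] alone suffices. *)
have /ex_minnP[i ix imin] : exists i, (G (2 * q i))^-1 < x.
  exists (Num.truncn x^-1); rewrite -[ltRHS]invrK ltf_pV2 ?posrE ?invr_gt0//.
  apply: (lt_le_trans (lt_knot_truncn _)).
  apply: le_trans (convex_phi_ge_id _).
  by have := knotr_gt0 R (Num.truncn x^-1); lra.
have h0 : 0 <= peak_height i by case: (i).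
have u0 : 0 < 2 * q i by rewrite mulr_gt0// knotr_gt0.
have := rearr_peak_shift_le a (lt_phi_inv u0 ix).
move=> /(ext_phi_le h0)/le_trans; apply.
case: i imin {ix h0 u0} => [|k] imin /=.
  by rewrite convex_phi0; apply: nneseries_ge0 => *; exact: S0.
apply: le_trans (nneseries_lim_ge k.+1 _); last by move=> *; exact: S0.
rewrite big_nat_recr//= -[leLHS]add0e leeD//; first by apply: sume_ge0.
rewrite indicE mem_set/= ?mule1// in_itv/= (ltW x0)/= leNgt.
by apply/negP => /imin; rewrite ltnn.
Qed.

Lemma L1G_peak_shift (a : R) : L1G G (fun x => peak (x - a)).
Proof.
split; first exact: measurable_peak_shift.
apply: (@le_lt_trans _ _ 1%E); last exact: ltry.
apply: ereal_inf_lbound; exists 1 => //; split => //.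
rewrite invr1; apply: le_trans (integral_steps_le
  (a := fun j => G (q j)) (b := fun j => (G (2 * q j))^-1) _ _ _ _) _.
- by move=> j; rewrite convex_phi_ge0.
- by move=> j; rewrite invr_ge0 convex_phi_ge0// mulr_ge0.
- by move=> x _; exact: ext_phi_rearr_ge0.
- by move=> x x0; rewrite mule1; exact: modular_peak_shift_le.
(* The exponent [2 * j + 1] is weakened to [j + 1], giving a geometric series of sum exactly 1, so
   that [c = 1] is admissible. *)
apply: (@le_trans _ _ (\sum_(0 <= k <oo) (1 / (2 ^ (k + 1))%:R)%:E)%E).
  apply: lee_nneseries => [j _ _|j _].
    by rewrite lee_fin divr_ge0 ?convex_phi_ge0 ?mulr_ge0.
  rewrite lee_fin (le_trans (convex_phi_jump _ _))// div1r.
  rewrite lef_pV2 ?posrE ?ltr0n ?expn_gt0// ler_nat leq_exp2l//; lia.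
have := @cvg_geometric_eseries_half R 1 0.
by move=> /cvg_lim; rewrite /eseries/= => ->//; rewrite expr0 divr1.
Qed.

(** Each peak reaches [q j] on an interval of length [(2 * q j)^-1 <= 1/2]. The two intervals,
    starting at 0 and 1, are disjoint, so their lengths add up to [(q j)^-1]. *)
Lemma rearr_peak_sum_ge (y : R) (j : nat) : y <= (q j)^-1 ->
  ((q j)%:E <= rearr (fun x => peak (x - 0) + peak (x - 1))%R y)%E.
Proof.
move=> yj; have q0 := knotr_gt0 R j.
apply: ereal_sup_ubound; exists (q j) => //; split; first exact: ltW.
pose b := (2 * q j)^-1.
have b0 : 0 < b by rewrite invr_gt0 mulr_gt0.
have b1 : b <= 2^-1.
  by rewrite lef_pV2 ?posrE ?mulr_gt0// ler_peMr// knotr_ge1.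
apply: (@le_trans _ _ (mu (`]0, (0 + b)] `|` `]1, (1 + b)])%classic)).
  rewrite measureU//=; last first.
    apply/seteqP; split => // x [] /=.
    rewrite !in_itv/= => /andP[_ xb] /andP[x1 _].
    by have : (1 : R) < 1; [|rewrite ltxx]; lra.
  rewrite !lebesgue_measure_ocitv ?(ltW b0)// lee_fin (le_trans yj)//.
  rewrite /b le_eqVlt; apply/orP; left; apply/eqP; field.
  by rewrite gt_eqF.
apply: le_measure; rewrite ?inE.
- by apply: measurableU.
- apply: measurable_level_set.
  by apply: measurable_funD; exact: measurable_peak_shift.
move=> x [] /=; rewrite in_itv/= => /andP[x0 xb]; split.
- by rewrite /nonneg/= ltW.
- rewrite ger0_norm ?addr_ge0 ?peak_ge0//.
  apply: (@le_trans _ _ (peak (x - 0))); last by rewrite lerDl peak_ge0.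
  by apply/(peak_geP _ q0); exists j; split => //; move: xb; rewrite /b; lra.
- by rewrite /nonneg/= ltW// (lt_trans _ x0).
- rewrite ger0_norm ?addr_ge0 ?peak_ge0//.
  apply: (@le_trans _ _ (peak (x - 1))); last by rewrite lerDr peak_ge0.
  by apply/(peak_geP _ q0); exists j; split => //; move: xb x0; rewrite /b; lra.
Qed.

Lemma modular_peak_sum_gt1 (c : R) : 0 < c ->
  (1 < \int[mu]_(x in @nonneg R)
    ext_phi G (rearr (fun x => peak (x - 0) + peak (x - 1))%R
      (phi_inv (phi_tilde G) x) * (c^-1)%:E))%E.
Proof.
move=> c0.
(* The shift of the index places it beyond [c], as [convex_phi_knot_div] requires. *)
pose s j := q (Num.truncn c + j).+2.
have s0 j : 0 < s j by exact: knotr_gt0.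
have Gs0 j : 0 < G (s j) by exact: convex_phi_gt0.
(* Each term is at least [(4 * c)^-1]: a factor [(2 * c)^-1] comes from dividing the knot by [c],
   and a factor 1/2 from the step width, as [G] at least doubles between knots. More than [4 * c]
   terms then exceed 1. *)
pose m := (Num.truncn (4 * c)).+1.
apply: lt_le_trans (integral_steps_ge (a := fun j => G (s j / c))
  (b := fun j => (G (s j))^-1) m _ _ _ _ _).
- have mc : 4 * c < m%:R by exact: truncnS_gt.
  rewrite lte_fin; apply: (@lt_le_trans _ _ (\sum_(j < m) (4 * c)^-1)).
    rewrite sumr_const card_ord -[ltRHS]mulr_natl ltr_pdivlMr ?mulr_gt0//.
    by rewrite mul1r.
  apply: ler_sum => j _.
  apply: (@le_trans _ _ (G (s j) / (2 * c) * ((G (s j))^-1 / 2))).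
    by rewrite le_eqVlt; apply/orP; left; apply/eqP; field; rewrite !gt_eqF.
  apply: ler_pM.
  + by rewrite divr_ge0 ?mulr_ge0// ltW.
  + by rewrite divr_ge0// invr_ge0 ltW.
  + apply: convex_phi_knot_div => //.
    by rewrite (le_trans (ltW (truncnS_gt c)))// ler_nat ltnS leq_addr.
  + have : (G (s j.+1))^-1 <= (2 * G (s j))^-1.
      rewrite lef_pV2 ?posrE ?mulr_gt0//.
      by rewrite /s addnS; exact: convex_phi_knot_double.
    by rewrite invfM; lra.
- by move=> j; rewrite convex_phi_ge0// divr_ge0// ltW.
- by move=> j; rewrite invr_ge0 ltW.
- move=> j; rewrite lef_pV2 ?posrE// convex_phi_nd// /s addnS; exact: ler_knotS.
- by move=> x _; rewrite ext_phi_rearr_ge0// invr_ge0 ltW.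
- move=> j x x0 xj; apply: ext_phi_ge; rewrite EFinM lee_wpmul2r//.
    by rewrite lee_fin invr_ge0 ltW.
  apply: rearr_peak_sum_ge; apply: phi_inv_le x0 _; first exact: s0.
  exact: xj.
Qed.

Lemma not_L1G_peak_sum : ~ L1G G (fun x => peak (x - 0) + peak (x - 1)).
Proof.
move=> [_]; apply/negP; rewrite -leNgt.
(* No [c] is admissible, so the infimum is that of the empty set, [+oo]. *)
apply: le_ereal_inf_tmp => _ [c [c0 hc] <-].
by have := lt_le_trans (modular_peak_sum_gt1 c0) hc; rewrite ltxx.
Qed.

End Peak.

Theorem theorem4p2 (R : realType) :
  exists G : R -> R,
    [/\ phi_function G, dilatory G & ~ quasi_Banach_L1G G].
Proof.
exists (@convex_phi R); split.
- exact: convex_phi_phi_function.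
- exact: convex_phi_dilatory.
move=> [[addG _] _ _ _ _]; apply: (@not_L1G_peak_sum R).
exact: addG (L1G_peak_shift _) (L1G_peak_shift _).
Qed.
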